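(* Let $q>1$ and $M\ge1$, and let $p_0\in[1,q]$ be the (unique) solution in $[1,q]$ of the equation $$\frac{q-p_0}{q-1}\,(Mp_0)^{1/(q-1)}=1 .$$ Then for every $p\in(p_0,q]$ there exists a finite constant $M'=M'(p,q,M)$, depending only on $p,q,M$, such that the following holds: for every non-decreasing function $f:[0,1)\to[0,\infty)$ satisfying $$\left(\frac1t\int_0^t f(y)\,dy\right)\left(\frac1t\int_0^t f(y)^{-1/(q-1)}\,dy\right)^{q-1}\le M\quad\text{for every } t\in(0,1],$$ one has $$\left(\frac1t\int_0^t f(y)\,dy\right)\left(\frac1t\int_0^t f(y)^{-1/(p-1)}\,dy\right)^{p-1}\le M'\quad\text{for every } t\in(0,1].$$ Additionally, the result is best possible, in the sense that $p_0$ cannot be decreased: for every $q>1$, $M\ge1$ and every $p_1$ with $1\le p_1<p_0$, the assertion obtained by replacing the range $p\in(p_0,q]$ above with $p\in(p_1,q]$ is false.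
   Context: Integrals of nonnegative measurable functions take values in $[0,+\infty]$. Conventions: $0^{-r}=+\infty$ for $r>0$, and $0\cdot(+\infty)=0$. *)

(* Defs.v *)
(* MathComp-Analysis *)
From mathcomp Require Import all_boot all_order all_algebra.
From mathcomp Require Import all_classical all_reals all_analysis.

Set Implicit Arguments.
Unset Strict Implicit.
Unset Printing Implicit Defensive.

Import Order.TTheory GRing.Theory Num.Theory.
Import numFieldNormedType.Exports.

Local Open Scope classical_set_scope.
Local Open Scope ring_scope.

(* a^{-r} with 0^{-r} = +oo; the real-valued 0 `^ (- r) is 0 for r != 0. *)
Definition neg_power (R : realType) (a r : R) : \bar R :=
  if a == 0 then +oo%E else (a `^ (- r))%:E.

Definition initial_mean (R : realType) (g : R -> \bar R) (t : R) : \bar R :=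
  ((t^-1)%R%:E * \int[@lebesgue_measure R]_(y in `[0%R, t[%classic) g y)%E.

(* A function [0,1) -> [0,oo) is a total function on R of which only the
   values on [0,1) are ever used. *)
Definition nonneg_nondecreasing01 (R : realType) (f : R -> R) : Prop :=
  {in `[0, 1[, forall x, 0 <= f x} /\
  {in `[0, 1[ &, {homo f : x y / x <= y}}.

(* The Muckenhoupt A_p condition on the intervals (0,t], with constant M;
   meaningful for 1 < p. *)
Definition initial_Ap (R : realType) (p M : R) (f : R -> R) : Prop :=
  forall t : R, 0 < t <= 1 ->
    (initial_mean (fun y => (f y)%:E) t *
     (initial_mean (fun y => neg_power (f y) (1 / (p - 1))%R) t) `^ (p - 1)%R
     <= M%:E)%E.

Definition critical_exponent (R : realType) (q M p0 : R) : Prop :=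
  1 <= p0 <= q /\
  (q - p0) / (q - 1) * (M * p0) `^ (1 / (q - 1)) = 1.

Definition self_improves_above (R : realType) (q M p0 : R) : Prop :=
  forall p : R, p0 < p <= q ->
  exists M' : R, forall f : R -> R, nonneg_nondecreasing01 f ->
    initial_Ap q M f -> initial_Ap p M' f.

(* Main.v *)
Require Import Defs.
From mathcomp Require Import all_boot all_order all_algebra.
From mathcomp Require Import all_classical all_reals all_analysis.
From mathcomp Require Import measurable_realfun ring lra.

Import Order.TTheory GRing.Theory Num.Theory.
Import numFieldNormedType.Exports.

Local Open Scope classical_set_scope.
Local Open Scope ring_scope.

Set Implicit Arguments.
Unset Strict Implicit.

(** Why the theorem holds.

    Put v = f^(-1/(q-1)), F(t) = int_0^t f, G(t) = int_0^t v and
    P(t) = F(t) G(t)^(q-1) / t^q, so that 1 <= P <= M: the lower bound is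
    Hoelder's inequality, the upper one is the hypothesis.  The relative slopes
    a = t f / F and b = t v / G satisfy a b^(q-1) P = 1 at every point, because
    f v^(q-1) = 1.  On the power weight y^(p0 - 1) they are constant, equal to
    p0 and (q - p0)/(q - 1), and P is then constantly M: this is the equation
    that defines p0.

    Fix r in ]p0, p[ and b1 = (q - r)/(q - 1); then M r b1^(q-1) <= 1, since
    the left side of the equation for p0 decreases
    ([critical_function_decreasing], [critical_exponent_gt]).  The tangent form
    of the weighted arithmetic-geometric inequality ([weighted_amgm_ln]) gives
    a + m b >= q r with m = r (q - 1)/b1.  Now a + m b is the derivative of
    ln F + m ln G with respect to ln t, so F G^m t^(-qr) is nondecreasing
    ([log_product_growth]).  Written as P G^k t^(q-qr), where k = m - (q - 1) > 0,
    this quantity has P pinned between 1 and M, which leaves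
    G(t) <= M^(1/k) G(T) (t/T)^b1 for t <= T ([primitive_decay]).  As v is
    nonincreasing, v(t) <= G(t)/t = O(t^(-(r-1)/(q-1))) ([dual_pair_decay]), and
    f^(-1/(p-1)) = v^((q-1)/(p-1)) = O(t^(-(r-1)/(p-1))), whose exponent exceeds
    -1 because r < p.  Integrating bounds the mean of f^(-1/(p-1)) by a constant
    times (G(T)/T)^((q-1)/(p-1)), and the A_q condition at T concludes
    ([self_improvement]).

    Derivatives of F and G need not exist everywhere.  They are avoided: the
    pointwise inequality is integrated over ]s, t[ with F and G frozen at t,
    which yields increments of ln F + m ln G at least q r (t - s)/t, and a
    geometric subdivision of [s, t] turns that bound into q r ln(t/s)
    ([log_increments]).

    For sharpness, f(y) = y^(p0 - 1) satisfies the A_q condition with constant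
    exactly M ([critical_power_initial_Ap]), whereas f^(-1/(p0-1)) = 1/y is not
    integrable at 0 ([critical_exponent_sharp]). *)

(** * The critical exponent *)

Lemma ln_lt_sub1 (R : realType) (x : R) : 0 < x -> x != 1 -> ln x < x - 1.
Proof.
move=> x0 x1; have /expR_gt1Dx : ln x != 0 by rewrite ln_eq0.
by rewrite lnK ?posrE//; lra.
Qed.

Lemma ln_le_sub1 (R : realType) (x : R) : 0 < x -> ln x <= x - 1.
Proof.
have [-> _|x1 x0] := eqVneq x 1; first by rewrite ln1 subrr.
exact/ltW/ln_lt_sub1.
Qed.

Lemma ln_sub_lt (R : realType) (x y : R) :
  0 < x -> 0 < y -> x != y -> ln y - ln x < y / x - 1.
Proof.
move=> x0 y0 xy; rewrite -ln_div ?posrE//; apply: ln_lt_sub1.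
  exact: divr_gt0.
by apply: contra xy => /eqP/divr1_eq ->.
Qed.

Lemma ln_sub_le (R : realType) (x y : R) :
  0 < x -> 0 < y -> ln y - ln x <= y / x - 1.
Proof.
move=> x0 y0; rewrite -ln_div ?posrE//; apply: ln_le_sub1; exact: divr_gt0.
Qed.

(** After taking logarithms this compares ln ((q-r)/(q-p)) with
    -(ln (r/p))/(q-1); the bound ln x < x - 1 applied to both ratios leaves
    the sign of (r - p) q (p - 1), which is where 1 <= p enters. *)
Lemma critical_function_decreasing (R : realType) (q M p r : R) :
  1 < q -> 0 < M -> 1 <= p -> p < r -> r <= q ->
  (q - r) / (q - 1) * (M * r) `^ (1 / (q - 1)) <
  (q - p) / (q - 1) * (M * p) `^ (1 / (q - 1)).
Proof.
move=> q1 M0 p1 pr; rewrite le_eqVlt => /predU1P[rq|rq].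
  rewrite {}rq in pr *; rewrite subrr !mul0r.
  apply: mulr_gt0; first by apply: divr_gt0; lra.
  by apply: powR_gt0; apply: mulr_gt0 => //; lra.
have [q10 [qr0 [qp0 [p0 r0]]]] :
  (0 < q - 1 /\ (0 < q - r /\ (0 < q - p /\ (0 < p /\ 0 < r))))%R.
  by repeat split; lra.
have pos x : 0 < q - x -> 0 < x ->
    0 < (q - x) / (q - 1) * (M * x) `^ (1 / (q - 1)).
  by move=> ? ?; rewrite mulr_gt0 ?divr_gt0 ?powR_gt0 ?mulr_gt0.
have iq0 : 0 < (q - 1)^-1 by rewrite invr_gt0.
rewrite -ltr_ln ?posrE ?pos//.
rewrite !lnM ?ln_powR ?posrE ?divr_gt0 ?powR_gt0 ?mulr_gt0//.
rewrite !lnM ?lnV ?posrE ?invr_gt0// -subr_gt0.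
have npr : q - p != q - r by rewrite gt_eqF// ltrD2l ltrN2.
have h1 := @ln_sub_lt _ (q - p) (q - r) qp0 qr0 npr.
have h2 := @ln_sub_lt _ p r p0 r0 (negbT (lt_eqF pr)).
have h3 : (ln r - ln p) / (q - 1) < (r - p) / p / (q - 1).
  by rewrite ltr_pM2r ?invr_gt0// mulrBl divff ?gt_eqF.
have h4 : (q - r) / (q - p) - 1 + (r - p) / p / (q - 1) <= 0.
  have -> : (q - r) / (q - p) - 1 + (r - p) / p / (q - 1) =
    - ((r - p) * q * (p - 1) / (p * (q - 1) * (q - p))).
    by field; rewrite !gt_eqF.
  rewrite oppr_le0 divr_ge0// !mulr_ge0//; lra.
move: h1 h3 h4; rewrite mul1r.
set a := _^-1; set b := _ - 1; set c := _ / p / _.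
move=> h1 h3 h4; nra.
Qed.

(** The function of [critical_function_decreasing] is at least 1 at 1, because
    1 <= M, and vanishes at q. *)
Lemma critical_exponent_unique (R : realType) (q M : R) :
  1 < q -> 1 <= M -> exists! p0, critical_exponent q M p0.
Proof.
move=> q1 M1; pose g p := (q - p) / (q - 1) * (M * p) `^ (1 / (q - 1)).
have /IVT ivt : 1 <= q by lra.
have [||p0 pq gp0] := ivt g 1.
- apply: derivable_within_continuous => x; rewrite in_itv/= => /andP[x1 xq].
  apply: derivableM.
    apply: derivableM; last exact: derivable_cst.
    by apply: derivableB; [exact: derivable_cst|exact: derivable_id].
  have Mx : 0 < M * x by apply: mulr_gt0; lra.
  apply/derivable1_diffP.
  apply: (@differentiable_comp _ _ _ _ ( *%R M) (@powR R ^~ (1 / (q - 1)))).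
    by apply/derivable1_diffP; apply: derivableM.
  apply/derivable1_diffP; apply: derivable_powR.
  by rewrite in_itv/= Mx.
- rewrite /g subrr !mul0r mulr1 divff ?mul1r; last by apply/eqP => ?; lra.
  have h : 1 <= M `^ (q - 1)^-1.
    by rewrite -[leLHS](powRr0 M) ler_powR// invr_ge0//; lra.
  by rewrite ge_min le_max h ler01 orbT.
exists p0; split; first by split => //; rewrite (itvP pq).
move=> p [/andP[p1 pq'] gp].
have M0 : 0 < M by lra.
have [lt|lt|//] := ltgtP p0 p.
- have := @critical_function_decreasing _ q M p0 p q1 M0.
  by rewrite (itvP pq) lt pq' gp -[_ * _]/(g p0) gp0 ltxx => /(_ isT isT isT).
- have := @critical_function_decreasing _ q M p p0 q1 M0.
  rewrite (itvP pq) lt p1 gp -[X in X < _]/(g p0) gp0 ltxx.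
  by move=> /(_ isT isT isT).
Qed.

(** * From a pointwise inequality to growth of primitives *)

(** Concavity of ln at [a0] and [b0], with the weights chosen so that the right
    side controls the logarithm of the product a b^k alone. *)
Lemma weighted_amgm_ln (R : realType) (k a0 b0 a b : R) :
  0 < k -> 0 < a0 -> 0 < b0 -> 0 < a -> 0 < b ->
  a0 * (1 + k + (ln a + k * ln b) - (ln a0 + k * ln b0)) <=
  a + a0 * k / b0 * b.
Proof.
move=> k0 a00 b00 a_gt0 b_gt0.
have h1 := @ln_sub_le _ a0 a a00 a_gt0.
have h2 := @ln_sub_le _ b0 b b00 b_gt0.
have -> : a + a0 * k / b0 * b = a0 * (a / a0 + k * (b / b0)).
  by field; rewrite !gt_eqF.
rewrite ler_pM2l//; have : k * (ln b - ln b0) <= k * (b / b0 - 1).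
  by rewrite ler_pM2l.
by rewrite !mulrBr; lra.
Qed.

(** The hypothesis is the inequality h' >= n/t with the derivative replaced by
    a one-sided difference quotient; summing it along a geometric progression
    from [s] to [t] of ratio close to 1 recovers the integral of n/t. *)
Lemma log_increments (R : realType) (h : R -> R) (n T : R) : 0 <= n ->
  (forall s t, 0 < s -> s < t -> t <= T -> n * ((t - s) / t) <= h t - h s) ->
  forall s t, 0 < s -> s < t -> t <= T -> n * (ln t - ln s) <= h t - h s.
Proof.
move=> n0 hh s t s0 st tT.
have t0 : 0 < t by lra.
pose x := ln t - ln s.
have x0 : 0 < x by rewrite subr_gt0 ltr_ln.
have step N : n * (x / (1 + x / N.+1%:R)) <= h t - h s.
  pose d := x / N.+1%:R.
  have N0 : 0 < N.+1%:R :> R by rewrite ltr0n.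
  have d0 : 0 < d by rewrite divr_gt0.
  have Nd : N.+1%:R * d = x by rewrite /d mulrC divfK ?gt_eqF.
  pose y k := s * expR (k%:R * d).
  have yS k : y k.+1 = y k * expR d.
    by rewrite /y -natr1 mulrDl mul1r expRD mulrA.
  have y0 k : 0 < y k by rewrite mulr_gt0// expR_gt0.
  have yN : y N.+1 = t.
    rewrite /y Nd /x -ln_div ?posrE// lnK ?posrE ?divr_gt0//.
    by rewrite mulrC divfK ?gt_eqF.
  have yle k : (k <= N.+1)%N -> y k <= T.
    move=> kN; apply: le_trans tT; rewrite -yN.
    by rewrite ler_pM2l// ler_expR ler_pM2r// ler_nat.
  have ylt k : y k < y k.+1.
    by rewrite ltr_pM2l// ltr_expR ltr_pM2r// ltr_nat.
  have onestep k : (k < N.+1)%N -> n * (d / (1 + d)) <= h (y k.+1) - h (y k).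
    move=> kN; apply: le_trans (hh _ _ (y0 k) (ylt k) (yle _ kN)).
    apply: ler_wpM2l => //; rewrite yS.
    have e0 := expR_gt0 d; have ed := expR_ge1Dx d.
    have -> : (y k * expR d - y k) / (y k * expR d) = 1 - (expR d)^-1.
      by field; rewrite !gt_eqF.
    have -> : d / (1 + d) = 1 - (1 + d)^-1 by field; apply/eqP => ?; lra.
    by rewrite lerD2l lerN2 lef_pV2 ?posrE//; lra.
  have sumstep k : (k <= N.+1)%N -> k%:R * (n * (d / (1 + d))) <= h (y k) - h (y 0%N).
    elim: k => [_|k ih kN]; first by rewrite mul0r subrr.
    have := ih (ltnW kN); have := onestep k kN; rewrite -natr1 mulrDl mul1r; lra.
  have := sumstep N.+1 (leqnn _).
  rewrite yN /y mul0r expR0 mulr1; apply: le_trans.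
  rewrite -/d -{1}Nd.
  by have -> : n * (N.+1%:R * d / (1 + d)) = N.+1%:R * (n * (d / (1 + d))) by ring.
(* x / (1 + x / N) tends to x, with error at most x^2 / N *)
rewrite -/x; apply/ler_addgt0Pr => e e0.
have nx : 0 <= n * x by rewrite mulr_ge0// ltW.
pose N := Num.truncn (n * x * x / e).
have N0 : 0 < N.+1%:R :> R by rewrite ltr0n.
rewrite -lerBlDr; apply: le_trans (step N).
have hN : n * x * (x / N.+1%:R) <= e.
  rewrite mulrA ler_pdivrMr// [leRHS]mulrC -ler_pdivrMr//.
  exact/ltW/truncnS_gt.
have z0 : 0 < x / N.+1%:R by rewrite divr_gt0.
move: hN z0; set z := x / _ => hN z0.
have -> : n * (x / (1 + z)) = n * x - n * x * z / (1 + z).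
  by field; apply/eqP => ?; lra.
rewrite lerD2l lerN2 ler_pdivrMr; last lra.
by apply: le_trans hN _; nra.
Qed.

Lemma Rintegral_gt0 (R : realType) (a b : R) (f : R -> R) : a < b ->
  (@lebesgue_measure R).-integrable `]a, b[ (EFin \o f) ->
  (forall y : R, a < y < b -> 0 < f y) ->
  0 < \int[@lebesgue_measure R]_(y in `]a, b[) f y.
Proof.
move=> ab intf f0; rewrite lt_neqAle Rintegral_ge0 ?andbT; last first.
  by move=> y/=; rewrite in_itv/= => /f0/ltW.
apply/negP => /eqP h.
have /integrableP[mf _] := intf.
have aeq := (ae_eq_integral_abs (@lebesgue_measure R) (measurable_itv _) mf).1.
have : (\int[@lebesgue_measure R]_(y in `]a, b[) `|(EFin \o f) y| = 0)%E.
  have -> : (\int[@lebesgue_measure R]_(y in `]a, b[) `|(EFin \o f) y| =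
      \int[@lebesgue_measure R]_(y in `]a, b[) (EFin \o f) y)%E.
    apply: eq_integral => y; rewrite inE/= in_itv/= => /f0 fy.
    by rewrite ger0_norm// ltW.
  by rewrite -[LHS]fineK ?integrable_fin_num// -[fine _]h.
move/aeq => [N [mN N0 sub]].
have sub' : `]a, b[%classic `<=` N.
  move=> y; rewrite /= in_itv/= => yab; apply: sub => /=; rewrite in_itv/= => /(_ yab)[fy0].
  by have := f0 y yab; rewrite fy0 ltxx.
have : (lebesgue_measure `]a, b[%classic <= lebesgue_measure N)%E.
  by apply: le_measure => //; rewrite inE.
move: N0 => /= ->.
by rewrite lebesgue_measure_itv/= lte_fin ab -EFinB lee_fin; lra.
Qed.

Lemma linear_combination_Rintegral (R : realType) (s t A B c : R) (f v : R -> R) :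
  s < t ->
  (@lebesgue_measure R).-integrable `]s, t[ (EFin \o f) ->
  (@lebesgue_measure R).-integrable `]s, t[ (EFin \o v) ->
  (forall y : R, s < y < t -> c <= A * f y + B * v y) ->
  c * (t - s) <= A * (\int[@lebesgue_measure R]_(y in `]s, t[) f y) +
                 B * (\int[@lebesgue_measure R]_(y in `]s, t[) v y).
Proof.
move=> st intf intv h.
have iA : (@lebesgue_measure R).-integrable `]s, t[ (EFin \o (fun y => A * f y)).
  exact: (@integrableZl _ _ _ (@lebesgue_measure R) _ _ A _ intf).
have iB : (@lebesgue_measure R).-integrable `]s, t[ (EFin \o (fun y => B * v y)).
  exact: (@integrableZl _ _ _ (@lebesgue_measure R) _ _ B _ intv).
rewrite -!RintegralZl//; rewrite -RintegralD//.
have -> : c * (t - s) = \int[@lebesgue_measure R]_(y in `]s, t[) c.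
  by rewrite Rintegral_cst//= lebesgue_measure_itv/= lte_fin st.
apply: le_Rintegral => //.
- apply/integrableP; split; first exact: measurable_cst.
  rewrite integral_cst//= lebesgue_measure_itv/= lte_fin st -EFinB -EFinM.
  exact: ltry.
- exact: (@integrableD _ _ _ (@lebesgue_measure R) _ _ _ _ iA iB).
Qed.

Definition primitive (R : realType) (g : R -> R) (t : R) : R :=
  \int[@lebesgue_measure R]_(y in `]0, t[) g y.

Lemma integrable_subitv (R : realType) (T : R) (g : R -> R) (s t : R) :
  (@lebesgue_measure R).-integrable `]0, T[ (EFin \o g) ->
  0 <= s -> t <= T -> (@lebesgue_measure R).-integrable `]s, t[ (EFin \o g).
Proof.
move=> intg s0 tT; apply: integrableS intg => // y /=.
by rewrite !in_itv/= => /andP[sy yt]; apply/andP; split; lra.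
Qed.

Lemma primitive_sub (R : realType) (T : R) (g : R -> R) (s t : R) :
  (@lebesgue_measure R).-integrable `]0, T[ (EFin \o g) ->
  0 <= s -> s < t -> t <= T ->
  primitive g t - primitive g s = \int[@lebesgue_measure R]_(y in `]s, t[) g y.
Proof.
move=> intg s0 st tT.
rewrite -(@Rintegral_itvB _ _ (BRight 0) (BLeft t) s) ?bnd_simp//.
  rewrite -(@Rintegral_itv_bndo_bndc _ (BRight 0) s)//.
  by apply: integrable_subitv intg _ _ => //; lra.
exact: integrable_subitv intg _ _.
Qed.

Lemma primitive_gt0 (R : realType) (T : R) (g : R -> R) (t : R) :
  (@lebesgue_measure R).-integrable `]0, T[ (EFin \o g) ->
  (forall y : R, 0 < y < T -> 0 < g y) -> 0 < t -> t <= T -> 0 < primitive g t.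
Proof.
move=> intg g0 t0 tT; apply: Rintegral_gt0 => //.
  exact: integrable_subitv intg _ _.
by move=> y /andP[y0 yt]; apply: g0; apply/andP; split; lra.
Qed.

(** The normalisation f v^(q-1) = 1 is stated with logarithms, the form in which
    every later estimate uses it.  The interval is open at 0 because a
    nondecreasing weight may vanish there, and at [T] because the weight is
    meaningful on [0, 1[ only. *)
Record dual_pair (R : realType) (q T : R) (f v : R -> R) : Prop := DualPair {
  dual_intl : (@lebesgue_measure R).-integrable `]0, T[ (EFin \o f) ;
  dual_intr : (@lebesgue_measure R).-integrable `]0, T[ (EFin \o v) ;
  dual_gt0l : forall y : R, 0 < y < T -> 0 < f y ;
  dual_gt0r : forall y : R, 0 < y < T -> 0 < v y ;
  dual_ln : forall y : R, 0 < y < T -> ln (f y) + (q - 1) * ln (v y) = 0 }.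

(** [weighted_amgm_ln] at a = t f / F(t) and b = t v / G(t), integrated over
    ]s, t[.  Freezing F and G at the right end [t] keeps the integrand linear in
    f and v. *)
Lemma dual_pair_step (R : realType) (q T : R) (f v : R -> R) (a0 b0 s t : R) :
  dual_pair q T f v -> 1 < q ->
  0 < a0 -> 0 < b0 -> 0 <= s -> s < t -> t <= T ->
  a0 * (q + (q * ln t - (ln (primitive f t) + (q - 1) * ln (primitive v t)))
          - (ln a0 + (q - 1) * ln b0)) * ((t - s) / t) <=
  (primitive f t - primitive f s) / primitive f t +
  a0 * (q - 1) / b0 * ((primitive v t - primitive v s) / primitive v t).
Proof.
move=> [intf intv f0 v0 fv] q1 a00 b00 s0 st tT; set c := a0 * _.
have t0 : 0 < t by lra.
have := primitive_gt0 intf f0 t0 tT; have := primitive_gt0 intv v0 t0 tT.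
have := @linear_combination_Rintegral _ s t (primitive f t)^-1
   (a0 * (q - 1) / b0 / primitive v t) (c / t) f v st
   (integrable_subitv intf s0 tT) (integrable_subitv intv s0 tT).
rewrite -(primitive_sub intf)// -(primitive_sub intv)//.
move: (primitive f s) (primitive v s) @c => Fs Gs.
move: (primitive f t) (primitive v t) => Ft Gt c + Gt0 Ft0.
have -> : c / t * (t - s) = c * ((t - s) / t) by ring.
have -> : Ft^-1 * (Ft - Fs) + a0 * (q - 1) / b0 / Gt * (Gt - Gs) =
   (Ft - Fs) / Ft + a0 * (q - 1) / b0 * ((Gt - Gs) / Gt) by ring.
apply => y /andP[sy yt].
have yT : 0 < y < T by apply/andP; split; lra.
have fy := f0 y yT; have vy := v0 y yT.
have k0 : 0 < q - 1 by lra.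
have := @weighted_amgm_ln _ (q - 1) a0 b0 (t * f y / Ft) (t * v y / Gt) k0 a00 b00.
rewrite !divr_gt0 ?mulr_gt0// => /(_ isT isT).
rewrite !ln_div ?posrE ?mulr_gt0// !lnM ?posrE//.
have -> : 1 + (q - 1) + (ln t + ln (f y) - ln Ft +
            (q - 1) * (ln t + ln (v y) - ln Gt)) =
  q + (q * ln t - (ln Ft + (q - 1) * ln Gt)) +
    (ln (f y) + (q - 1) * ln (v y)) by ring.
rewrite fv// addr0 -/c => h; rewrite ler_pdivrMr//; apply: le_trans h _.
by rewrite le_eqVlt; apply/orP; left; apply/eqP; ring.
Qed.

(** The case s = 0, a0 = b0 = 1 of [dual_pair_step], where both relative
    increments equal 1. *)
Lemma hoelder_log (R : realType) (q T : R) (f v : R -> R) (t : R) :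
  dual_pair q T f v -> 1 < q -> 0 < t -> t <= T ->
  q * ln t <= ln (primitive f t) + (q - 1) * ln (primitive v t).
Proof.
move=> fv q1 t0 tT; have := dual_pair_step fv q1 ltr01 ltr01 (lexx 0) t0 tT.
have FG0 g : primitive g 0 = 0 :> R.
  by rewrite /primitive set_itv_ge ?bnd_simp ?ltxx// Rintegral_set0.
have [intf intv f0 v0 _] := fv.
have := primitive_gt0 intf f0 t0 tT; have := primitive_gt0 intv v0 t0 tT.
rewrite !FG0 !subr0.
move: (primitive f t) (primitive v t) => Ft Gt Gt0 Ft0.
by rewrite !divff ?gt_eqF// ln1; lra.
Qed.

(** The condition on [r] and [b] says M r b^(q-1) <= 1, so that the bracket in
    [dual_pair_step] is at least q as soon as the A_q bound holds. *)
Lemma log_product_growth (R : realType) (q T M r b : R) (f v : R -> R) (s t : R) :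
  dual_pair q T f v -> 1 < q -> 0 < r -> 0 < b ->
  ln M + ln r + (q - 1) * ln b <= 0 ->
  (forall t : R, 0 < t -> t <= T ->
    ln (primitive f t) + (q - 1) * ln (primitive v t) <= ln M + q * ln t) ->
  0 < s -> s < t -> t <= T ->
  r * q * (ln t - ln s) <=
  (ln (primitive f t) + r * (q - 1) / b * ln (primitive v t)) -
  (ln (primitive f s) + r * (q - 1) / b * ln (primitive v s)).
Proof.
move=> fv q1 r0 b0 rM Aq s0 st tT; set m := r * _ / b; move: s t s0 st tT.
have m0 : 0 < m by rewrite divr_gt0// mulr_gt0//; lra.
have [intf intv f0 v0 _] := fv.
pose h (t : R) : R := ln (primitive f t) + m * ln (primitive v t).
apply: (@log_increments R h (r * q) T); first by apply: mulr_ge0; lra.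
move=> s t s0 st tT.
have t0 : 0 < t by lra.
have sT : s <= T by lra.
have := Aq t t0 tT.
have := primitive_gt0 intf f0 t0 tT; have := primitive_gt0 intv v0 t0 tT.
have := primitive_gt0 intf f0 s0 sT; have := primitive_gt0 intv v0 s0 sT.
have := dual_pair_step fv q1 r0 b0 (ltW s0) st tT; rewrite -/m /h.
move: (primitive f t) (primitive v t) (primitive f s) (primitive v s).
move=> Ft Gt Fs Gs; rewrite !mulrBl => + Gs0 Fs0 Gt0 Ft0.
rewrite !divff ?gt_eqF// => hc hA.
have hF := ln_sub_le Ft0 Fs0; have hG := ln_sub_le Gt0 Gs0.
rewrite -(ler_pM2l m0) in hG.
have d0 : 0 <= 1 - s / t by rewrite subr_ge0 ler_pdivrMr//; lra.
suff : r * q * (1 - s / t) <= 1 - Fs / Ft + m * (1 - Gs / Gt) by lra.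
apply: le_trans hc; rewrite ler_wpM2r// ler_wpM2l//; lra.
Qed.

Lemma critical_gap (R : realType) (q r : R) : 1 < q ->
  r - (q - r) / (q - 1) = q * (r - 1) / (q - 1).
Proof. by move=> q1; field; rewrite subr_eq0 gt_eqF. Qed.

(** With m = r (q-1)/b = (q-1) + k, the monotone quantity of
    [log_product_growth] is (F G^(q-1)) G^k t^(-qr).  Hoelder's inequality at [t]
    and the A_q bound at [T] replace the first factor by powers of t and T, up to
    the constant M, and
    (qr - q)/k = b is what remains as exponent. *)
Lemma primitive_decay (R : realType) (q T M r : R) (f v : R -> R) (t : R) :
  dual_pair q T f v -> 1 < q -> 1 < r -> r < q ->
  let b := (q - r) / (q - 1) in
  ln M + ln r + (q - 1) * ln b <= 0 ->
  (forall t : R, 0 < t -> t <= T ->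
    ln (primitive f t) + (q - 1) * ln (primitive v t) <= ln M + q * ln t) ->
  0 < t -> t < T ->
  ln (primitive v t) <= ln (primitive v T) + ln M / ((q - 1) * (r - b) / b) +
    b * (ln t - ln T).
Proof.
move=> fv q1 r1 rq b rM Aq t0 tT.
have b0 : 0 < b by rewrite divr_gt0//; lra.
have r0 : 0 < r by lra.
have T0 : 0 < T by lra.
have := log_product_growth fv q1 r0 b0 rM Aq t0 tT (lexx _).
have := Aq T T0 (lexx _); have := hoelder_log fv q1 t0 (ltW tT).
have rb := @critical_gap _ q r q1; rewrite -/b in rb.
have rb0 : 0 < r - b by rewrite rb divr_gt0 ?mulr_gt0//; lra.
have q10 : 0 < q - 1 by lra.
set k := _ * (r - b) / b; have k0 : 0 < k by rewrite divr_gt0// mulr_gt0.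
have mE : r * (q - 1) / b = q - 1 + k by rewrite /k; field; rewrite gt_eqF.
have kb : k * b = r * q - q.
  by rewrite /k divfK ?gt_eqF// rb mulrC divfK ?gt_eqF//; ring.
have kM : k * (ln M / k) = ln M by rewrite mulrC divfK ?gt_eqF.
have kbt : k * (b * (ln t - ln T)) = (r * q - q) * (ln t - ln T).
  by rewrite mulrA kb.
move=> h1 h2; rewrite mE => h3.
rewrite -(ler_pM2l k0) 2!(mulrDr k) kM kbt; lra.
Qed.

Lemma dual_pair_decay (R : realType) (q T M r : R) (f v : R -> R) (y : R) :
  dual_pair q T f v -> 1 < q -> 1 < r -> r < q ->
  let b := (q - r) / (q - 1) in
  ln M + ln r + (q - 1) * ln b <= 0 ->
  (forall t : R, 0 < t -> t <= T ->
    ln (primitive f t) + (q - 1) * ln (primitive v t) <= ln M + q * ln t) ->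
  (forall x y : R, 0 < x -> x <= y -> y < T -> v y <= v x) ->
  0 < y -> y < T ->
  v y <= expR (ln M / ((q - 1) * (r - b) / b)) * (primitive v T / T) *
         (y / T) `^ (- ((r - 1) / (q - 1))).
Proof.
move=> fv q1 r1 rq b rM Aq v_dec y0 yT.
have [intf intv f0 v0 _] := fv.
have T0 : 0 < T by lra.
have Gy := primitive_gt0 intv v0 y0 (ltW yT).
have GT := primitive_gt0 intv v0 T0 (lexx _).
have yT0 : 0 < y / T by rewrite divr_gt0.
have Ty0 : 0 < T^-1 by rewrite invr_gt0.
have iy0 : 0 < y^-1 by rewrite invr_gt0.
have : v y <= primitive v y / y.
  have := @linear_combination_Rintegral _ 0 y 0 1 (v y) f v y0
   (integrable_subitv intf (lexx _) (ltW yT)) (integrable_subitv intv (lexx _) (ltW yT)).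
  rewrite ler_pdivlMr// subr0 mul0r mul1r add0r; apply => z /andP[z0 zy].
  by rewrite mul0r mul1r add0r; apply: v_dec => //; exact: ltW.
move/le_trans; apply; have := primitive_decay fv q1 r1 rq rM Aq y0 yT.
rewrite -/b; move: (primitive v y) (primitive v T) Gy GT => Gy GT Gy0 GT0 h.
rewrite -ler_ln ?posrE ?mulr_gt0 ?divr_gt0 ?expR_gt0 ?powR_gt0//.
rewrite ln_div ?posrE// !lnM ?posrE ?mulr_gt0 ?divr_gt0 ?expR_gt0 ?powR_gt0//.
rewrite expRK ln_powR ln_div ?posrE// lnV ?posrE//.
have -> : - ((r - 1) / (q - 1)) = b - 1.
  by rewrite /b; field; rewrite subr_eq0 gt_eqF.
lra.
Qed.

(** * Measurability and means of powers *)

Lemma nondecreasing_on_measurable (R : realType) (i : interval R) (f : R -> R) :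
  {in i &, {homo f : x y / x <= y}} -> measurable_fun [set` i] f.
Proof.
move=> f_nd.
apply: (measurability (@RGenCInfty.G R)) => [|/= _ [_] [r] -> <-].
  exact: RGenCInfty.measurableE.
apply: is_interval_measurable => s t [si fs] [ti _] u sut.
have ui : [set` i] u by exact: interval_is_interval si ti _ sut.
split => //; move: fs; rewrite /= !in_itv/= !andbT => /le_trans; apply.
by apply: f_nd => //; case/andP: sut.
Qed.

Lemma measurable_neg_power (R : realType) (r : R) (D : set R) (f : R -> R) :
  measurable_fun D f -> measurable_fun D (fun y => neg_power (f y) r).
Proof.
move=> mf; apply: (@measurableT_comp _ _ _ _ _ _ (fun a => neg_power a r)) => //.
apply: measurable_fun_ifT.
- exact: measurable_fun_eqr.
- exact: measurable_cst.
- by apply/measurable_EFinP; exact: measurable_powR.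
Qed.

Lemma initial_mean_open (R : realType) (g h : R -> \bar R) (t : R) :
  measurable_fun `]0, t[ h -> (forall y : R, 0 < y < t -> g y = h y) ->
  initial_mean g t =
  ((t^-1)%:E * \int[@lebesgue_measure R]_(y in `]0%R, t[%classic) h y)%E.
Proof.
move=> mh gh; have mg : measurable_fun `]0, t[ g.
  by apply: eq_measurable_fun mh => y; rewrite inE/= in_itv/= => /gh ->.
rewrite /initial_mean integral_itv_bndoo//; congr (_ * _)%E.
by apply: eq_integral => y; rewrite inE/= in_itv/= => /gh ->.
Qed.

Lemma initial_mean_primitive (R : realType) (g : R -> \bar R) (h : R -> R) (t : R) :
  (@lebesgue_measure R).-integrable `]0, t[ (EFin \o h) ->
  (forall y : R, 0 < y < t -> g y = (h y)%:E) ->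
  initial_mean g t = (primitive h t / t)%:E.
Proof.
move=> inth gh; rewrite (@initial_mean_open _ _ (EFin \o h))//.
  rewrite -[X in (_ * X)%E]fineK; last exact: integrable_fin_num.
  by rewrite -EFinM mulrC.
by have /integrableP[] := inth.
Qed.

Lemma integral_powR (R : realType) (c t : R) : -1 < c -> 0 < t ->
  (\int[@lebesgue_measure R]_(y in `]0%R, t[%classic) (y `^ c)%:E =
   (t `^ (c + 1) / (c + 1))%:E)%E.
Proof.
move=> c1 t0.
have mp D : measurable_fun D (fun y : R => (y `^ c)%:E).
  by apply/measurable_EFinP; apply: measurable_funTS; exact: measurable_powR.
have c10 : 0 < c + 1 by lra.
rewrite integral_itv_bndo_bndc//.
pose e (n : nat) : R := t / n.+2%:R.
have n2 n : 0 < n.+2%:R :> R by rewrite ltr0n.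
have e0 n : 0 < e n by rewrite divr_gt0.
have et n : e n < t by rewrite ltr_pdivrMr// ltr_pMr// ltr1n.
pose P (x : R) : R := x `^ (c + 1) / (c + 1).
have dP (x : R) : 0 < x -> is_derive x 1 P (x `^ c).
  move=> x0; have := is_derive1_powR (c + 1) x0.
  rewrite (_ : c + 1 - 1 = c); last by ring.
  move=> h; rewrite /P.
  apply: (@is_derive_eq _ _ _ (fun y : R => y `^ (c + 1) * (c + 1)^-1)).
  by rewrite scaler0 add0r /GRing.scale/= mulKf// gt_eqF.
have FTC n : (\int[@lebesgue_measure R]_(y in `[e n, t]%classic) (y `^ c)%:E =
    (P t)%:E - (P (e n))%:E)%E.
  have cP (x : R) : 0 < x -> {for x, continuous P}.
    by move=> x0; have [/derivable1_diffP/differentiable_continuous] := dP x x0.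
  apply: continuous_FTC2 => //.
  - apply: derivable_within_continuous => x; rewrite in_itv/= => /andP[ex _].
    by apply: derivable_powR; rewrite in_itv/= andbT (lt_le_trans (e0 n)).
  - split.
    + move=> x; rewrite in_itv/= => /andP[ex _].
      by have [] := dP x (lt_trans (e0 n) ex).
    + by apply: cvg_at_right_filter; exact: cP.
    + by apply: cvg_at_left_filter; exact: cP.
  - move=> x; rewrite in_itv/= => /andP[ex _].
    by rewrite derive1E; have [] := dP x (lt_trans (e0 n) ex).
have UE : `]0, t]%classic = \bigcup_n `[e n, t]%classic.
  apply/seteqP; split => x /=.
    rewrite in_itv/= => /andP[x0 xt].
    exists (Num.truncn (t / x)) => //=; rewrite in_itv/= xt andbT.
    rewrite ler_pdivrMr// mulrC -ler_pdivrMr//.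
    apply: le_trans (ltW (truncnS_gt _)) _; rewrite ler_nat//.
  move=> [n _] /=; rewrite !in_itv/= => /andP[ex ->].
  by rewrite (lt_le_trans (e0 n)).
rewrite UE.
transitivity (limn (fun n => \int[@lebesgue_measure R]_(y in `[e n, t]%classic)
    (y `^ c)%:E)%E).
  apply/esym/cvg_lim => //; apply: ge0_nondecreasing_set_cvg_integral => //.
    move=> m n mn; apply/subsetPset => x /=; rewrite !in_itv/= => /andP[ex ->].
    rewrite andbT; apply: le_trans ex; rewrite ler_pM2l// lef_pV2 ?posrE//.
    by rewrite ler_nat !ltnS.
    by move=> n; exact: mp.
  by move=> n x _; rewrite lee_fin powR_ge0.
under eq_fun do rewrite FTC.
apply/cvg_lim => //.
rewrite -[X in _ --> X]sube0; apply: cvgeB => //.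
  exact: cvg_cst.
apply: cvg_EFin; first exact: nearW.
rewrite [X in _ --> X](_ : 0 = 0 / (c + 1)); last by rewrite mul0r.
rewrite /comp /=; apply: cvgMl.
have := powR_cvg0 c10; move/cvg_at_rightP; apply; split => //.
rewrite -[X in _ --> X](mulr0 t); apply: cvgMr.
have := @cvg_harmonic R; rewrite -cvg_shiftS /=. exact.
Qed.

Lemma initial_mean_powR (R : realType) (g : R -> \bar R) (c t : R) :
  -1 < c -> 0 < t -> (forall y : R, 0 < y < t -> g y = (y `^ c)%:E) ->
  initial_mean g t = (t `^ c / (c + 1))%:E.
Proof.
move=> c1 t0 gc; rewrite (initial_mean_open _ gc); last first.
  by apply/measurable_EFinP; apply: measurable_funTS; exact: measurable_powR.
rewrite integral_powR// -EFinM mulrA; congr (_ / _)%:E.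
rewrite powRD; last by rewrite (gt_eqF t0) implybT.
by rewrite powRr1 ?(ltW t0)// mulrCA mulVf ?gt_eqF// mulr1.
Qed.

(** The factor T^(-c) hidden in (y/T)^(-c) makes the bound independent of [T]. *)
Lemma initial_mean_le_powR (R : realType) (g : R -> \bar R) (h : R -> R) (K c T : R) :
  0 < T -> 0 <= K -> c < 1 -> measurable_fun `]0, T[ h ->
  (forall y : R, 0 < y < T -> g y = (h y)%:E) ->
  (forall y : R, 0 < y < T -> 0 <= h y <= K * (y / T) `^ (- c)) ->
  (initial_mean g T <= (K / (1 - c))%:E)%E.
Proof.
move=> T0 K0 c1 mh gh hK.
have c10 : 0 < 1 - c by lra.
have mh' : measurable_fun `]0, T[ (fun y => (h y)%:E) by exact/measurable_EFinP.
rewrite (initial_mean_open mh' gh).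
pose A := K * T `^ c.
have A0 : 0 <= A by rewrite mulr_ge0// powR_ge0.
apply: (@le_trans _ _ ((T^-1)%:E *
  \int[@lebesgue_measure R]_(y in `]0%R, T[%classic) (A%:E * (y `^ (- c))%:E))%E).
  rewrite lee_wpmul2l ?lee_fin ?invr_ge0 ?(ltW T0)//.
  apply: ge0_le_integral => //.
  - by move=> y; rewrite /= in_itv/= => /hK/andP[h0 _]; rewrite lee_fin.
  - apply/measurable_EFinP; apply: measurable_funM => //.
    by apply: measurable_funTS; exact: measurable_powR.
  - move=> y; rewrite /= in_itv/= => yT; have /andP[_] := hK y yT.
    case/andP: yT => y0 _; rewrite lee_fin => /le_trans; apply.
    rewrite powRM ?invr_ge0 ?(ltW y0) ?(ltW T0)//.
    rewrite -(powR_inv1 (ltW T0)) -powRrM mulN1r opprK.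
    by rewrite /A mulrAC mulrA.
rewrite ge0_integralZl//; last 2 first.
  - apply/measurable_EFinP; apply: measurable_funTS; exact: measurable_powR.
  - by move=> y _; rewrite lee_fin powR_ge0.
rewrite integral_powR//; last by lra.
rewrite -!EFinM lee_fin /A.
have TE : T `^ c * T `^ (- c + 1) = T.
  rewrite -powRD; last by rewrite (gt_eqF T0) implybT.
  by rewrite addrA subrr add0r powRr1// ltW.
rewrite (addrC _ 1) in TE *.
have -> : T^-1 * (K * T `^ c * (T `^ (1 - c) / (1 - c))) =
  K / (1 - c) * (T^-1 * (T `^ c * T `^ (1 - c))) by ring.
by rewrite TE mulVf ?gt_eqF// mulr1.
Qed.

Lemma neg_power_ge0 (R : realType) (a r : R) : (0 <= neg_power a r)%E.
Proof. by rewrite /neg_power; case: ifP => // _; rewrite lee_fin powR_ge0. Qed.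

Lemma neg_power_neq0 (R : realType) (a r : R) :
  a != 0 -> neg_power a r = (a `^ (- r))%:E.
Proof. by rewrite /neg_power => /negbTE ->. Qed.

(** * Self-improvement of the A_q condition *)

(** The A_q bound at [T] with a nonzero mean of f forces the mean of
    f^(-1/(q-1)) to be finite; hence f cannot vanish on ]0, T[, since it would
    then vanish near 0, where f^(-1/(q-1)) would be infinite.  The second mean
    being positive, the first one is finite too. *)
Lemma initial_Ap_dual_pair (R : realType) (q M T : R) (f : R -> R) :
  1 < q -> nonneg_nondecreasing01 f -> initial_Ap q M f -> 0 < T -> T <= 1 ->
  initial_mean (fun y => (f y)%:E) T != 0%E ->
  dual_pair q T f (fun y => f y `^ (- (1 / (q - 1)))).
Proof.
move=> q1 [f0 f_nd] Aq T0 T1 mean_neq0.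
have q10 : 0 < q - 1 by lra.
set r := 1 / (q - 1); set v := fun y => _.
have sub y : y \in `[0, T[ -> y \in `[0, 1[.
  by rewrite !in_itv/= => /andP[-> yT]; apply: lt_le_trans T1.
have mf : measurable_fun `[0, T[ f.
  by apply: nondecreasing_on_measurable => x y /sub x1 /sub y1; exact: f_nd.
have mN := measurable_neg_power r mf.
pose N y : \bar R := neg_power (f y) r.
have N0 y : (0 <= N y)%E by exact: neg_power_ge0.
have IN0 : (0 <= \int[@lebesgue_measure R]_(y in `[0%R, T[%classic) N y)%E.
  by apply: integral_ge0 => y _; exact: N0.
have If0 : (0 <= \int[@lebesgue_measure R]_(y in `[0%R, T[%classic) (f y)%:E)%E.
  by apply: integral_ge0 => y /sub y1; rewrite lee_fin f0.
have iT0 : (0 < (T^-1)%:E)%E by rewrite lte_fin invr_gt0.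
have mean_gt0 : (0 < initial_mean (fun y => (f y)%:E) T)%E.
  by rewrite lt_neqAle eq_sym mean_neq0/= mule_ge0// ltW.
have T01 : 0 < T <= 1 by rewrite T0.
have AqT := Aq T T01.
have INfin : (\int[@lebesgue_measure R]_(y in `[0%R, T[%classic) N y < +oo)%E.
  rewrite ltey; apply: contraTN isT => /eqP INy.
  move: AqT; rewrite [initial_mean (fun y => neg_power _ _) _]/initial_mean.
  by rewrite INy gt0_muley// poweRyr ?gt_eqF// gt0_muley.
have fpos y : 0 < y < T -> 0 < f y.
  move=> /andP[y0 yT]; have yT' : y \in `[0, T[ by rewrite in_itv/= ltW.
  rewrite lt_neqAle f0 ?andbT; last exact: sub.
  apply: contraTN isT => /eqP fy.
  have subi : `]0, y[%classic `<=` `[0, T[%classic.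
    move=> z; rewrite /= !in_itv/= => /andP[/ltW -> zy].
    exact: lt_trans zy yT.
  suff INy : (+oo <= \int[@lebesgue_measure R]_(y in `[0%R, T[%classic) N y)%E.
    by move: INfin; rewrite ltNge INy.
  apply: (@le_trans _ _ (\int[@lebesgue_measure R]_(z in `]0%R, y[%classic) N z)%E).
    have -> : (\int[@lebesgue_measure R]_(z in `]0%R, y[%classic) N z =
        \int[@lebesgue_measure R]_(z in `]0%R, y[%classic) cst +oo%E z)%E; last first.
      rewrite integral_cst//= lebesgue_measure_itv/= lte_fin y0.
      by rewrite gt0_mulye// lte_fin; lra.
    apply: eq_integral => z; rewrite inE => zy; rewrite /N /neg_power.
    have zT := subi _ zy; move: (zy); rewrite /= in_itv/= => /andP[z0 /ltW zy'].
    have -> // : f z == 0.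
    by rewrite eq_le f0 ?sub// {1}fy f_nd// sub.
  by apply: ge0_subset_integral => // z _.
have fN y : 0 < y < T -> N y = (v y)%:E.
  by move=> /fpos fy; rewrite /N neg_power_neq0// gt_eqF.
have oo_co : `]0, T[%classic `<=` `[0, T[%classic.
  by move=> z; rewrite /= !in_itv/= => /andP[/ltW -> ->].
have mf' : measurable_fun `]0, T[ f by exact: measurable_funS mf.
have mv : measurable_fun `]0, T[ v.
  exact: (@measurableT_comp _ _ _ _ _ _ (@powR R ^~ (- r))).
have vpos y : 0 < y < T -> 0 < v y by move=> /fpos fy; exact: powR_gt0.
have intv : (@lebesgue_measure R).-integrable `]0, T[ (EFin \o v).
  apply/integrableP; split; first exact/measurable_EFinP.
  apply: le_lt_trans INfin.
  have -> : (\int[@lebesgue_measure R]_(y in `]0%R, T[%classic) `|(EFin \o v) y| =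
      \int[@lebesgue_measure R]_(y in `]0%R, T[%classic) N y)%E; last first.
    by apply: ge0_subset_integral => // z _.
  apply: eq_integral => y; rewrite inE/= in_itv/= => yT; rewrite fN//.
  by rewrite ger0_norm// ltW// vpos.
have intf : (@lebesgue_measure R).-integrable `]0, T[ (EFin \o f).
  apply/integrableP; split; first exact/measurable_EFinP.
  have -> : (\int[@lebesgue_measure R]_(y in `]0%R, T[%classic) `|(EFin \o f) y| =
      \int[@lebesgue_measure R]_(y in `]0%R, T[%classic) (f y)%:E)%E.
    apply: eq_integral => y; rewrite inE/= in_itv/= => yT /=.
    by rewrite ger0_norm// ltW// fpos.
  rewrite -(@integral_itv_bndoo _ _ _ _ true true); last exact/measurable_EFinP.
  rewrite ltey; apply: contraTN isT => /eqP Ify.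
  move: AqT; rewrite [initial_mean (fun y => (f y)%:E) _]/initial_mean.
  rewrite Ify gt0_muley// (initial_mean_primitive intv fN)/=.
  rewrite gt0_mulye// lte_fin powR_gt0// divr_gt0//.
  exact: primitive_gt0 intv vpos T0 (lexx _).
by split => // y yT; rewrite /v ln_powR /r; field; rewrite subr_eq0 gt_eqF.
Qed.

Lemma initial_Ap_real (R : realType) (q M T : R) (f : R -> R) (t : R) :
  let v := fun y => f y `^ (- (1 / (q - 1))) in
  dual_pair q T f v -> T <= 1 -> initial_Ap q M f -> 0 < t -> t <= T ->
  primitive f t / t * (primitive v t / t) `^ (q - 1) <= M.
Proof.
move=> v [intf intv f0 v0 _] T1 Aq t0 tT.
have sub y : 0 < y < t -> 0 < y < T.
  by move=> /andP[-> yt]; apply: lt_le_trans tT.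
have t01 : 0 < t <= 1 by rewrite t0 (le_trans tT).
have := Aq t t01.
rewrite (initial_mean_primitive (integrable_subitv intf (lexx _) tT))//.
rewrite (initial_mean_primitive (integrable_subitv intv (lexx _) tT)).
  by rewrite poweR_EFin -EFinM lee_fin.
by move=> y /sub/f0 fy; rewrite neg_power_neq0// gt_eqF.
Qed.

Lemma initial_Ap_log (R : realType) (q M T : R) (f : R -> R) (t : R) :
  let v := fun y => f y `^ (- (1 / (q - 1))) in
  dual_pair q T f v -> T <= 1 -> initial_Ap q M f -> 0 < t -> t <= T ->
  ln (primitive f t) + (q - 1) * ln (primitive v t) <= ln M + q * ln t.
Proof.
move=> v fv T1 Aq t0 tT; have := initial_Ap_real fv T1 Aq t0 tT.
have [intf intv f0 v0 _] := fv.
have := primitive_gt0 intf f0 t0 tT; have := primitive_gt0 intv v0 t0 tT.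
rewrite -/v; move: (primitive f t) (primitive v t) => F G G0 F0 h.
have Ft0 : 0 < F / t by rewrite divr_gt0.
have Gt0 : 0 < G / t by rewrite divr_gt0.
have P0 : 0 < F / t * (G / t) `^ (q - 1) by rewrite mulr_gt0// powR_gt0.
have := h; rewrite -ler_ln ?posrE//; last exact: lt_le_trans h.
rewrite lnM ?posrE ?powR_gt0// ln_powR !ln_div ?posrE//.
by rewrite mulrBr; lra.
Qed.

(** The logarithm of the left side of the equation for p0, multiplied by q - 1. *)
Lemma critical_exponent_gt (R : realType) (q M p0 r : R) :
  1 < q -> 1 <= M -> critical_exponent q M p0 -> p0 < r -> r < q ->
  ln M + ln r + (q - 1) * ln ((q - r) / (q - 1)) <= 0.
Proof.
move=> q1 M1 [/andP[p01 p0q] gp0] p0r rq.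
have M0 : 0 < M by lra.
have := critical_function_decreasing q1 M0 p01 p0r (ltW rq).
rewrite gp0; have r0 : 0 < r by lra.
have q10 : 0 < q - 1 by lra.
have b0 : 0 < (q - r) / (q - 1) by rewrite divr_gt0//; lra.
move: b0; set b := (q - r) / _ => b0.
have P0 : 0 < (M * r) `^ (1 / (q - 1)) by rewrite powR_gt0// mulr_gt0.
rewrite -ltr_ln ?posrE ?(mulr_gt0 b0 P0)// ln1.
rewrite lnM ?posrE// ln_powR lnM ?posrE// => h.
suff : (q - 1) * (ln b + 1 / (q - 1) * (ln M + ln r)) <= 0.
  by rewrite mulrDr mulrA mul1r divff ?gt_eqF// mul1r; lra.
by rewrite pmulr_rle0// ltW.
Qed.

(** The constant is C^(q-1) (1-c)^(-(p-1)) M, where C is the constant of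
    [dual_pair_decay] and c = (r-1)/(p-1) < 1 the exponent of the resulting
    singularity.  The functions with mean zero on ]0, T[ are settled by
    0 * (+oo) = 0. *)
Lemma self_improvement (R : realType) (q M p0 : R) : 1 < q -> 1 <= M ->
  critical_exponent q M p0 -> self_improves_above q M p0.
Proof.
move=> q1 M1 cp0 p /andP[p0p pq].
have [/andP[p01 p0q] _] := cp0.
have [r [r1 p0r rp]] : exists r, [/\ 1 < r, p0 < r & r < p].
  by exists ((p0 + p) / 2); split; lra.
have rq : r < q by lra.
have p1 : 0 < p - 1 by lra.
have q10 : 0 < q - 1 by lra.
have rM := critical_exponent_gt q1 M1 cp0 p0r rq.
set b := (q - r) / (q - 1) in rM.
pose C := expR (ln M / ((q - 1) * (r - b) / b)).
pose c := (r - 1) / (p - 1).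
have c1 : c < 1 by rewrite /c ltr_pdivrMr//; lra.
exists (C `^ (q - 1) * (1 - c) `^ (- (p - 1)) * M) => f f01 Aq T /andP[T0 T1].
have M'0 : 0 <= C `^ (q - 1) * (1 - c) `^ (- (p - 1)) * M.
  by rewrite !mulr_ge0 ?powR_ge0//; lra.
have [->|mean_neq0] := eqVneq (initial_mean (fun y => (f y)%:E) T) 0%E.
  by rewrite mul0e lee_fin.
have fv := initial_Ap_dual_pair q1 f01 Aq T0 T1 mean_neq0.
have AqT := initial_Ap_real fv T1 Aq T0 (lexx _).
have Alog t := @initial_Ap_log _ q M T f t fv T1 Aq.
move: fv AqT Alog; set v := fun y => _ => fv AqT Alog.
have [intf intv f0 v0 _] := fv.
have v_dec (x y : R) : 0 < x -> x <= y -> y < T -> v y <= v x.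
  move=> x0 xy yT; have [_ f_nd] := f01.
  have xT := le_lt_trans xy yT; have y0 := lt_le_trans x0 xy.
  have fx : 0 < f x by rewrite f0 ?x0.
  have fy : 0 < f y by rewrite f0 ?y0.
  rewrite /v !powRN lef_pV2 ?posrE ?powR_gt0//.
  rewrite ge0_ler_powR ?nnegrE ?(ltW fx) ?(ltW fy) ?divr_ge0 ?(ltW q10)//.
  by apply: f_nd => //; rewrite in_itv/= ltW//= (lt_le_trans _ T1).
have decay y := dual_pair_decay fv q1 r1 rq rM Alog v_dec (y := y).
pose V := primitive v T / T.
have V0 : 0 < V by rewrite divr_gt0//; exact: primitive_gt0 intv v0 T0 (lexx _).
have F0 := primitive_gt0 intf f0 T0 (lexx _).
have C0 : 0 < C by exact: expR_gt0.
have CV0 : 0 <= C * V by rewrite ltW// mulr_gt0.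
have s0 : 0 < (q - 1) / (p - 1) by rewrite divr_gt0.
pose K := (C * V) `^ ((q - 1) / (p - 1)).
have mean_le : (initial_mean (fun y => neg_power (f y) (1 / (p - 1))) T <=
    (K / (1 - c))%:E)%E.
  apply: (initial_mean_le_powR (h := fun y => v y `^ ((q - 1) / (p - 1)))) => //.
  - exact: powR_ge0.
  - apply: (@measurableT_comp _ _ _ _ _ _ (@powR R ^~ ((q - 1) / (p - 1)))) => //.
    by have /integrableP[/measurable_EFinP] := intv.
  - move=> y yT; rewrite neg_power_neq0 ?gt_eqF ?f0// /v -powRrM.
    congr (_ `^ _)%:E; field.
    by rewrite !subr_eq0 !gt_eqF//; lra.
  - move=> y yT; rewrite powR_ge0/=; have vy := v0 y yT.
    case/andP: yT => y0 yT.
    have yT0 : 0 < y / T by rewrite divr_gt0.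
    have := decay y y0 yT; rewrite -/b -/C -/V => h.
    apply: (@le_trans _ _ ((C * V * (y / T) `^ (- ((r - 1) / (q - 1)))) `^ ((q - 1) / (p - 1)))).
      rewrite ge0_ler_powR ?nnegrE ?(ltW vy) ?(ltW s0)//.
      by rewrite mulr_ge0 ?powR_ge0.
    rewrite powRM ?powR_ge0// -/K -powRrM.
    rewrite (_ : - ((r - 1) / (q - 1)) * ((q - 1) / (p - 1)) = - c)//.
    by rewrite /c; field; rewrite !subr_eq0 !gt_eqF//; lra.
rewrite (initial_mean_primitive intf)//.
have c0 : 0 < 1 - c by lra.
have mean_ge0 : (0 <= initial_mean (fun y => neg_power (f y) (1 / (p - 1))) T)%E.
  rewrite mule_ge0 ?lee_fin ?invr_ge0 ?(ltW T0)//.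
  by apply: integral_ge0 => y _; exact: neg_power_ge0.
apply: (@le_trans _ _ ((primitive f T / T)%:E * (K / (1 - c))%:E `^ (p - 1))%E).
  rewrite lee_wpmul2l ?lee_fin ?divr_ge0 ?(ltW F0) ?(ltW T0)//.
  apply: gt0_ler_poweR => //; rewrite ?in_itv/= ?mean_ge0 ?leey//.
    exact: ltW.
  by rewrite lee_fin divr_ge0 ?powR_ge0// ltW.
rewrite poweR_EFin -EFinM lee_fin.
have -> : (K / (1 - c)) `^ (p - 1) =
    C `^ (q - 1) * V `^ (q - 1) * (1 - c) `^ (- (p - 1)).
  rewrite powRM ?powR_ge0 ?invr_ge0 ?(ltW c0)//.
  rewrite -[X in _ * X `^ _]powR_inv1 ?(ltW c0)// -!powRrM mulN1r.
  by rewrite divfK ?gt_eqF// powRM// ltW.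
have -> : primitive f T / T * (C `^ (q - 1) * V `^ (q - 1) * (1 - c) `^ (- (p - 1))) =
  C `^ (q - 1) * (1 - c) `^ (- (p - 1)) * (primitive f T / T * V `^ (q - 1)) by ring.
by rewrite ler_wpM2l// mulr_ge0// powR_ge0.
Qed.

(** * Sharpness of the critical exponent *)

Lemma neg_power_powR (R : realType) (a r y : R) :
  0 < y -> neg_power (y `^ a) r = (y `^ (- (a * r)))%:E.
Proof.
by move=> y0; rewrite neg_power_neq0 ?gt_eqF ?powR_gt0// -powRrM mulrN.
Qed.

Lemma powR_nonneg_nondecreasing01 (R : realType) (a : R) :
  0 <= a -> nonneg_nondecreasing01 (fun y : R => y `^ a).
Proof.
move=> a0; split=> [x _|x y]; first exact: powR_ge0.
rewrite !in_itv/= => /andP[x0 _] /andP[y0 _] xy.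
by rewrite ge0_ler_powR.
Qed.

(** Both means are explicit powers of [t] that cancel in the product, leaving
    p0^(-1) ((q-1)/(q-p0))^(q-1), which equals M by the equation for p0. *)
Lemma critical_power_initial_Ap (R : realType) (q M p0 : R) : 1 < q -> 1 <= M ->
  critical_exponent q M p0 -> 1 < p0 -> p0 < q ->
  initial_Ap q M (fun y => y `^ (p0 - 1)).
Proof.
move=> q1 M1 [_ gp0] p01 p0q t /andP[t0 _].
have q10 : 0 < q - 1 by lra.
have p00 : 0 < p0 by lra.
have Mp0 : 0 <= M * p0 by rewrite mulr_ge0//; lra.
pose b := (q - p0) / (q - 1).
have b0 : 0 < b by rewrite divr_gt0//; lra.
pose c := - ((p0 - 1) * (1 / (q - 1))).
have cb : c + 1 = b by rewrite /c /b; field; rewrite subr_eq0 gt_eqF.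
rewrite (initial_mean_powR (c := p0 - 1))//; last lra.
rewrite (initial_mean_powR (c := c))//; last 2 first.
- by lra.
- by move=> y /andP[y0 _]; rewrite neg_power_powR.
rewrite poweR_EFin -EFinM lee_fin cb subrK.
have ib : b^-1 = (M * p0) `^ (1 / (q - 1)).
  by rewrite -[RHS](mulKf (lt0r_neq0 b0)) gp0 mulr1.
rewrite ib powRM ?powR_ge0// -!powRrM mul1r mulVf ?gt_eqF// powRr1//.
rewrite (_ : c * (q - 1) = - (p0 - 1)); last first.
  by rewrite /c; field; rewrite subr_eq0 gt_eqF.
rewrite powRN; have tp : 0 < t `^ (p0 - 1) by exact: powR_gt0.
rewrite le_eqVlt; apply/orP; left; apply/eqP; field.
by rewrite !gt_eqF.
Qed.

(** Comparison with y^(e-1) <= y^(-1), whose mean is 1/e, for e tending to 0. *)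
Lemma initial_mean_invr (R : realType) (g : R -> \bar R) :
  measurable_fun `]0 : R, 1 : R[ g -> (forall y : R, 0 < y < 1 -> g y = (y `^ (-1))%:E) ->
  initial_mean g 1 = +oo%E.
Proof.
move=> mg gE.
have lb (e : R) : 0 < e -> e < 1 -> ((e^-1)%:E <= initial_mean g 1)%E.
  move=> e0 e1.
  have <- : initial_mean (fun y : R => (y `^ (e - 1))%:E) 1 = (e^-1)%:E.
    rewrite (initial_mean_powR (c := e - 1))//; last lra.
    by rewrite powR1 subrK mul1r.
  have mp : measurable_fun `]0 : R, 1 : R[ (fun y : R => (y `^ (e - 1))%:E).
    by apply/measurable_EFinP; apply: measurable_funTS; exact: measurable_powR.
  rewrite /initial_mean (integral_itv_bndoo _ _ mp) (integral_itv_bndoo _ _ mg).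
  rewrite lee_wpmul2l ?lee_fin ?invr_ge0//.
  apply: ge0_le_integral => //.
  - by move=> y _; rewrite lee_fin powR_ge0.
  - move=> y; rewrite /= in_itv/= => y01; rewrite gE// lee_fin.
    case/andP: y01 => y0 y1; apply: ger_powR; last lra.
    by rewrite y0 ltW.
have := lb 2^-1; rewrite invrK; case: (initial_mean g 1) lb => // [x lb h|lb h].
- have x2 : 2 <= x by rewrite -lee_fin h//; lra.
  have a : 0 < (x + 1)^-1 by rewrite invr_gt0; lra.
  have b : (x + 1)^-1 < 1 by rewrite invf_lt1; lra.
  have := lb _ a b; by rewrite invrK lee_fin gerDl ler10.
- by have := h ltac:(lra) ltac:(lra).
Qed.

(** The exponent p = p0 is itself in ]p1, q], and there the power weight
    y^(p0-1) fails: its dual weight is 1/y. *)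
Lemma critical_exponent_sharp (R : realType) (q M p0 p1 : R) :
  1 < q -> 1 <= M -> critical_exponent q M p0 -> 1 <= p1 < p0 ->
  ~ self_improves_above q M p1.
Proof.
move=> q1 M1 cp0 /andP[p11 p1p0].
have [/andP[_ p0q] gp0] := cp0.
have p0q' : p0 < q.
  rewrite lt_neqAle p0q andbT; apply/eqP => e.
  by move: gp0; rewrite e subrr !mul0r => /esym/eqP; rewrite oner_eq0.
have p01 : 1 < p0 by lra.
have p010 : 0 < p0 - 1 by lra.
move=> /(_ p0); rewrite p1p0 p0q => /(_ isT)[M' improved].
pose f (y : R) : R := y `^ (p0 - 1).
have := improved f (powR_nonneg_nondecreasing01 (ltW p010))
  (critical_power_initial_Ap q1 M1 cp0 p01 p0q').
move=> /(_ 1); rewrite ltr01 lexx => /(_ isT).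
rewrite (initial_mean_powR (c := p0 - 1))//; last lra.
rewrite (@initial_mean_invr _ (fun y => neg_power (f y) (1 / (p0 - 1)))).
- by rewrite poweRyr ?gt_eqF// gt0_muley// lte_fin powR1 divr_gt0//; lra.
- apply: measurable_neg_power; apply: measurable_funTS; exact: measurable_powR.
- move=> y /andP[y0 _]; rewrite neg_power_powR//.
  by rewrite mulrA mulr1 divff ?gt_eqF.
Qed.

Theorem theorem3 (R : realType) (q M : R) (hq : 1 < q) (hM : 1 <= M) :
  (exists! p0 : R, critical_exponent q M p0) /\
  (forall p0 : R, critical_exponent q M p0 ->
     self_improves_above q M p0 /\
     (forall p1 : R, 1 <= p1 < p0 -> ~ self_improves_above q M p1)).
Proof.
split; first exact: critical_exponent_unique.
move=> p0 cp0; split; first exact: self_improvement.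
by move=> p1; exact: critical_exponent_sharp.
Qed.
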